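(* Let $k$ be a measurable kernel on a measurable space $\mathcal{X}$, let $p_0$ be the pre-change (reference) distribution on $\mathcal{X}$, let $h \ge 0$ and $\delta > 0$, and let $T_{\mathrm{KCUSUM}}$ be the change detector defined by the Kernel CUSUM algorithm with thresholds $h$ and $\delta$. Let $c_1 = \inf\{ m \ge 1 \mid \sum_{i=1}^{m} g_\delta(z_i) > h\}$. Then the time to false alarm is at least $$\operatorname{ARL2FA}_{\mathrm{KCUSUM}} \ge \frac{2}{\mathbb{P}_\infty(c_1 < \infty)}.$$ If $p_1$ is a (post-change) distribution with $d_k(p_0,p_1) > \sqrt{\delta}$, then the worst case detection delay is at most $$\operatorname{ESADD}_{\mathrm{KCUSUM}} \le 2\,\mathbb{E}_1[c_1].$$
   Context: Kernel and MMD distance. $(\mathcal{X},\Sigma)$ is a measurable space and $k:\mathcal{X}\times\mathcal{X}\to\mathbb{R}$ is a kernel: measurable for the product $\sigma$-algebra, symmetric, and positive definite in the sense that $\sum_{i,j=1}^n a_i a_j k(x_i,x_j)\ge 0$ for all $n$, all $x_1,\dots,x_n\in\mathcal{X}$ and all real $a_1,\dots,a_n$. Let $\mathcal{P}_k$ be the set of probability measures $\mu$ on $(\mathcal{X},\Sigma)$ with $\mathbb{E}_{x\sim\mu}[\sqrt{k(x,x)}]<\infty$. Whenever $d_k$ appears, $k$ is assumed characteristic (the kernel mean embedding $\mu\mapsto\int k(\cdot,x)\,d\mu(x)$ into the reproducing kernel Hilbert space of $k$ is injective on $\mathcal{P}_k$) and the measures involved lie in $\mathcal{P}_k$; then $$d_k(p_0,p_1)=\sqrt{\mathbb{E}_{p_0\times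 p_0}[k(x,x')]+\mathbb{E}_{p_1\times p_1}[k(y,y')]-2\mathbb{E}_{p_0\times p_1}[k(x,y)]}.$$ Data model. Observations $x_1,x_2,\dots$ are independent $\mathcal{X}$-valued random variables, and reference samples $y_1,y_2,\dots$ are i.i.d. with law $p_0$, independent of the observations. Under $\mathbb{P}_\infty$ (no change) all $x_i\sim p_0$. Under $\mathbb{P}_t$, $t\ge 1$ (change at time $t$), $x_i\sim p_0$ for $1\le i<t$ and $x_i\sim p_1$ for $i\ge t$. $\mathbb{E}_\infty,\mathbb{E}_t$ are the corresponding expectations. Let $\mathcal{F}_n=\sigma(x_1,y_1,\dots,x_n,y_n)$ (with $\mathcal{F}_0$ trivial). Shifted statistic: $g_\delta((x_0,x_1),(y_0,y_1)) = k(x_0,x_1)+k(y_0,y_1)-k(x_0,y_1)-k(x_1,y_0)-\delta$. Grouped variables: $z_n=(x_{2n-1},x_{2n},y_{2n-1},y_{2n})$ and $g_\delta(z_n)=g_\delta((x_{2n-1},x_{2n}),(y_{2n-1},y_{2n}))$ for $n\ge1$. Kernel CUSUM algorithm with thresholds $h\ge0$, $\delta>0$: set $Z_1=0$; for $n=2,3,\dots$ let $v_n=g_\delta((x_{n-1},x_n),(y_{n-1},y_n))$ if $n$ is even and $v_n=0$ if $n$ is odd, and $Z_n=\max\{0,Z_{n-1}+v_n\}$. Then $T_{\mathrm{KCUSUM}}=\inf\{n\ge2\mid Z_n>h\}$. Performance metrics of a change detector (stopping time with respect to $(\mathcal{F}_n)$) $T$: $\operatorname{ARL2FA}=\mathbb{E}_\infty[T]$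 and $\operatorname{ESADD}=\sup_{1\le t<\infty}\operatorname{esssup}\,\mathbb{E}_t[(T-t)^+\mid\mathcal{F}_{t-1}]$, where $(x)^+=\max\{0,x\}$. Conventions: $\inf\emptyset=\infty$, $2/0=\infty$. *)

(* Defs.v *)
From HB Require Import structures.
From mathcomp Require Import all_boot all_order all_algebra.
From mathcomp Require Import all_classical all_reals all_analysis.
From mathcomp Require Import measurable_realfun ess_sup_inf.

Set Implicit Arguments.
Unset Strict Implicit.
Unset Printing Implicit Defensive.

Import Order.TTheory GRing.Theory Num.Theory.
Import numFieldNormedType.Exports.

Local Open Scope classical_set_scope.
Local Open Scope ring_scope.

Section KernelDistance.
Context {d : measure_display} {X : measurableType d} {R : realType}.
Implicit Types (k : X * X -> R) (mu p : probability X R).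

Definition is_kernel k :=
  [/\ measurable_fun setT k,
      forall x y, k (x, y) = k (y, x) &
      forall (n : nat) (x : 'I_n -> X) (a : 'I_n -> R),
        0 <= \sum_(i < n) \sum_(j < n) a i * a j * k (x i, x j)].

Definition in_Pk k mu : Prop :=
  (\int[mu]_x (Num.sqrt (k (x, x)))%:E < +oo)%E.

(* The elements of the reproducing kernel Hilbert space of k are functions on
   X, and evaluation at a point is a continuous linear form on it; hence the
   element [\int k(., x) dmu(x)] of that space is the function below. *)
Definition mean_embedding k mu : X -> R :=
  fun z => \int[mu]_x k (z, x).

(* Measures are compared on measurable sets: the library's measures are total
   functions on [set X], with arbitrary values elsewhere. *)
Definition characteristic k :=
  forall mu nu : probability X R, in_Pk k mu -> in_Pk k nu ->
    mean_embedding k mu = mean_embedding k nu ->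
    forall A, measurable A -> mu A = nu A.

Definition mmd_dist k p0 p1 : R :=
  Num.sqrt (\int[(p0 \x p0)%E]_z k z + \int[(p1 \x p1)%E]_z k z
            - 2 * \int[(p0 \x p1)%E]_z k z).

End KernelDistance.

(* Sequences are indexed from 1, as functions on nat whose value at 0 is never
   used. Times are extended reals, so that inf of the empty set is +oo. *)
Section KCusum.
Context {X : Type} {R : realType}.
Variables (k : X * X -> R) (delta : R).

Definition gstat (a b : X * X) : R :=
  k (a.1, a.2) + k (b.1, b.2) - k (a.1, b.2) - k (a.2, b.1) - delta.

Definition gstat_group (x y : nat -> X) (n : nat) : R :=
  gstat (x (2 * n).-1, x (2 * n)%N) (y (2 * n).-1, y (2 * n)%N).

Definition kcusum_incr (x y : nat -> X) (n : nat) : R :=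
  if odd n then 0 else gstat (x n.-1, x n) (y n.-1, y n).

Fixpoint kcusum_stat (x y : nat -> X) (n : nat) : R :=
  match n with
  | (_.+1 as m).+1 => Num.max 0 (kcusum_stat x y m + kcusum_incr x y n)
  | _ => 0
  end.

Definition kcusum_time (h : R) (x y : nat -> X) : \bar R :=
  ereal_inf [set n%:R%:E | n in [set n | (2 <= n)%N /\ h < kcusum_stat x y n]].

Definition c1_time (h : R) (x y : nat -> X) : \bar R :=
  ereal_inf [set m%:R%:E | m in [set m |
    (1 <= m)%N /\ h < \sum_(1 <= i < m.+1) gstat_group x y i]].

End KCusum.

Section DataModel.
Context {d d' : measure_display} {X : measurableType d}
  {Omega : measurableType d'} {R : realType}.
Implicit Types (P : probability Omega R) (x y : nat -> {mfun Omega >-> X}).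

Definition pos_index : set nat := [set i | (1 <= i)%N].

Definition sigma_of (D : set nat) x : set_system Omega :=
  <<s \bigcup_(i in D) preimage_set_system setT (x i) measurable >>.

Definition mutually_independent P (D : set nat) x :=
  forall (s : seq nat) (A : nat -> set X), uniq s -> [set` s] `<=` D ->
    (forall i, measurable (A i)) ->
    P (\bigcap_(i in [set` s]) (x i @^-1` A i)) =
    (\prod_(i <- s) P (x i @^-1` A i))%E.

Definition independent_algebras P (F G : set_system Omega) :=
  forall A B, F A -> G B -> P (A `&` B) = (P A * P B)%E.

Definition has_law P (f : {mfun Omega >-> X}) (p : probability X R) :=
  forall A, measurable A -> distribution P f A = p A.

Definition data_model P x y (law : nat -> probability X R)
    (p0 : probability X R) :=
  [/\ mutually_independent P pos_index x,
      mutually_independent P pos_index y,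
      independent_algebras P (sigma_of pos_index x) (sigma_of pos_index y),
      forall i, (1 <= i)%N -> has_law P (x i) (law i) &
      forall i, (1 <= i)%N -> has_law P (y i) p0].

Definition no_change_model P x y (p0 : probability X R) :=
  data_model P x y (fun=> p0) p0.

Definition change_model P x y (p0 p1 : probability X R) (t : nat) :=
  data_model P x y (fun i => if (i < t)%N then p0 else p1) p0.

Definition filtration x y (n : nat) : set_system Omega :=
  let D := [set i | (1 <= i <= n)%N] in
  <<s sigma_of D x `|` sigma_of D y >>.

End DataModel.

Section Performance.
Context {d' : measure_display} {Omega : measurableType d'} {R : realType}.
Implicit Types (P : probability Omega R) (F : set_system Omega).
Local Open Scope ereal_scope.

(* Versions of the conditional expectation of a [0, +oo]-valued Y, which need
   not be integrable, given a sub-sigma-algebra F. *)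
Definition is_cond_exp P F (Y f : Omega -> \bar R) :=
  [/\ forall w, 0 <= f w,
      forall B, measurable B -> F (f @^-1` B) &
      forall A, F A -> \int[P]_(w in A) f w = \int[P]_(w in A) Y w].

(* Some version; should none exist, the value is +oo, so that an upper bound
   on the delay below cannot hold by default. *)
Definition cond_exp P F (Y : Omega -> \bar R) : Omega -> \bar R :=
  xget (cst +oo) [set f | is_cond_exp P F Y f].

Definition ARL2FA P (T : Omega -> \bar R) : \bar R := \int[P]_w T w.

Definition ESADD (P : nat -> probability Omega R) (F : nat -> set_system Omega)
    (T : Omega -> \bar R) : \bar R :=
  ereal_sup [set ess_sup (P t) (cond_exp (P t) (F t.-1)
                                  (fun w => maxe 0 (T w - t%:R%:E)))
            | t in [set t | (1 <= t)%N]].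

End Performance.

(* Main.v *)
Require Import Defs.
From HB Require Import structures.
From mathcomp Require Import all_boot all_order all_algebra.
From mathcomp Require Import all_classical all_reals all_analysis.
From mathcomp Require Import measurable_realfun ess_sup_inf.
From mathcomp Require Import zify.

Set Implicit Arguments.
Unset Strict Implicit.
Unset Printing Implicit Defensive.

Import Order.TTheory GRing.Theory Num.Theory.
Import numFieldNormedType.Exports.

Local Open Scope classical_set_scope.
Local Open Scope ring_scope.

(** Observations are processed in groups of two, so the statistic at even times
    is a classical CUSUM of the increments [gstat_group]: by the Lindley
    recursion, [Z_(2n)] is the largest of 0 and of the sums of the increments
    of groups [j + 1, .., n], over [j < n] ([block_sum_le_kcusum] and
    [kcusum_is_block_sum]).  Writing [c_j] for the time [c1] of the sequence
    that starts after group [j], the alarm time [T] is therefore the infimum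
    over [j] of [2 * (j + c_j)]; it is even or infinite.

    The probabilistic input is [past_future]: an event of [filtration x y m] is
    independent of the path after [m], whose law depends only on the laws of
    the observations and reference samples after [m].

    False alarms.  The event [T > 2j] depends only on the first [2j]
    observations and reference samples, hence is independent of [c_j < +oo],
    which has probability [a := P(c1 < +oo)].  Since [T] is even,
    [a * E(T) = 2 * \sum_j P(T > 2j) * a = 2 * \sum_j P(T > 2j, c_j < +oo)].
    If [E(T)] is finite, then [T] is almost surely finite, in which case some
    [j] with [2j < T] has [c_j < +oo]; so the last sum is at least 1, and
    [E(T) >= 2 / a].

    Detection delay.  Let [j := t./2], so that group [j + 1] is the first one
    that contains no observation before time [t].  Then [T - t <= 2 * c_j],
    where [c_j] is independent of [filtration x y t.-1] and has under [P t] the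
    law of [c1] under [P 1].  Hence the integral of [(T - t)^+] over an event
    [A] of the past is at most [2 * E_1(c1) * P t A], which bounds the
    conditional expectation almost everywhere ([ess_sup_cond_exp_le]).  When
    [E_1(c1)] is finite, the delay is integrable and a conditional expectation
    exists ([cond_exp_exists]); otherwise the bound is infinite. *)

(** * The statistic as a maximum of block sums *)

Section Pathwise.
Context {X : Type} {R : realType}.
Variables (k : X * X -> R) (delta : R).
Implicit Types x y : nat -> X.

Definition shift (m : nat) (x : nat -> X) : nat -> X := fun i => x (m + i)%N.

Definition block_sum x y (m : nat) : R :=
  \sum_(1 <= i < m.+1) gstat_group k delta x y i.

Lemma gstat_group_shift x y j n : (1 <= n)%N ->
  gstat_group k delta (shift (2 * j) x) (shift (2 * j) y) n =
  gstat_group k delta x y (j + n).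
Proof.
move=> n1; rewrite /gstat_group /shift.
have -> : (2 * j + (2 * n).-1 = (2 * (j + n)).-1)%N by lia.
by rewrite -mulnDr.
Qed.

Lemma block_sumS x y m :
  block_sum x y m.+1 = block_sum x y m + gstat_group k delta x y m.+1.
Proof. by rewrite /block_sum big_nat_recr. Qed.

Lemma kcusum_stat_ge0 x y n : 0 <= kcusum_stat k delta x y n.
Proof. by case: n => [|[|n]] //=; rewrite le_max lexx. Qed.

Lemma kcusum_statSS x y n :
  kcusum_stat k delta x y n.+2 =
  Num.max 0 (kcusum_stat k delta x y n.+1 + kcusum_incr k delta x y n.+2).
Proof. by []. Qed.

(** No increment is added at odd times. *)
Lemma kcusum_stat_odd x y j :
  kcusum_stat k delta x y (2 * j).+1 = kcusum_stat k delta x y (2 * j).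
Proof.
case: j => [|j]; first by [].
have -> : (2 * j.+1 = (2 * j).+2)%N by lia.
have incr0 : kcusum_incr k delta x y (2 * j).+3 = 0.
  by rewrite /kcusum_incr /= oddM.
by rewrite kcusum_statSS incr0 addr0 max_r // kcusum_stat_ge0.
Qed.

Lemma kcusum_stat_even x y j :
  kcusum_stat k delta x y (2 * j.+1) =
  Num.max 0 (kcusum_stat k delta x y (2 * j) + gstat_group k delta x y j.+1).
Proof.
have E : (2 * j.+1 = (2 * j).+2)%N by lia.
have incrE : kcusum_incr k delta x y (2 * j.+1) = gstat_group k delta x y j.+1.
  by rewrite /kcusum_incr oddM.
by rewrite -incrE E kcusum_statSS kcusum_stat_odd.
Qed.

Lemma block_sum_le_kcusum x y j m :
  block_sum (shift (2 * j) x) (shift (2 * j) y) m <=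
  kcusum_stat k delta x y (2 * (j + m)).
Proof.
elim: m => [|m IH]; first by rewrite /block_sum big_geq // kcusum_stat_ge0.
rewrite addnS kcusum_stat_even block_sumS gstat_group_shift // addnS.
by rewrite le_max lerD2r IH orbT.
Qed.

(** The sum starts after the last group at which the recursion was reset. *)
Lemma kcusum_is_block_sum x y n : exists2 j, (j <= n)%N &
  kcusum_stat k delta x y (2 * n) =
  block_sum (shift (2 * j) x) (shift (2 * j) y) (n - j).
Proof.
elim: n => [|n [j jn IH]].
  by exists 0%N => //; rewrite /block_sum big_geq.
rewrite kcusum_stat_even.
have [_|_] := leP 0 (_ + _).
  exists j; first exact: leqW.
  by rewrite subSn // block_sumS gstat_group_shift // IH addnS subnKC.
by exists n.+1 => //; rewrite subnn /block_sum big_geq.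
Qed.

End Pathwise.

(** * First times as extended reals *)

Section FirstTime.
Context {R : realType}.
Local Open Scope ereal_scope.

Definition first_time (A : set nat) : \bar R :=
  ereal_inf [set n%:R%:E | n in A].

Lemma first_time_le (A : set nat) n : A n -> first_time A <= n%:R%:E.
Proof. by move=> An; apply: ereal_inf_lbound; exists n. Qed.

Variant first_time_spec (A : set nat) : \bar R -> Prop :=
  | FirstNever of A = set0 : first_time_spec A +oo
  | FirstAt n of A n & (forall m, A m -> (n <= m)%N) :
      first_time_spec A n%:R%:E.

Lemma first_timeP (A : set nat) : first_time_spec A (first_time A).
Proof.
have [A0|/set0P[n0 An0]] := eqVneq A set0.
  by rewrite {2}A0 /first_time image_set0 ereal_inf0; exact: FirstNever.
have exA : exists n, `[< A n >] by exists n0; exact/asboolP.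
case: (ex_minnP exA) => n /asboolP An nmin.
have nmin' m : A m -> (n <= m)%N by move=> Am; apply: nmin; exact/asboolP.
suff -> : first_time A = n%:R%:E by exact: FirstAt.
apply/eqP; rewrite eq_le first_time_le //=.
by apply: le_ereal_inf_tmp => _ [m Am <-]; rewrite lee_fin ler_nat nmin'.
Qed.

Lemma first_time_ge0 (A : set nat) : 0 <= first_time A.
Proof. by case: first_timeP => // n _ _; rewrite lee_fin. Qed.

Lemma lt_first_time (A : set nat) r :
  r%:R%:E < first_time A <-> forall n, A n -> (r < n)%N.
Proof.
case: first_timeP => [->|n An nmin].
  by split => // _; rewrite ltry.
rewrite lte_fin ltr_nat; split => [rn m /nmin|]; last exact.
exact: leq_trans.
Qed.

Lemma first_time_lty (A : set nat) : (first_time A < +oo) <-> A !=set0.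
Proof.
case: first_timeP => [->|n An _]; first by split => // -[].
by rewrite ltry; split => // _; exists n.
Qed.

End FirstTime.

(** * The alarm time and the crossing times *)

Section KCusumTime.
Context {X : Type} {R : realType}.
Variables (k : X * X -> R) (delta h : R).
Implicit Types x y : nat -> X.

Definition alarms x y : set nat :=
  [set n | (2 <= n)%N /\ h < kcusum_stat k delta x y n].

Definition crossings x y : set nat :=
  [set m | (1 <= m)%N /\ h < block_sum k delta x y m].

Local Open Scope ereal_scope.

Lemma kcusum_timeE x y :
  kcusum_time k delta h x y = first_time (alarms x y).
Proof. by []. Qed.

Lemma c1_timeE x y : c1_time k delta h x y = first_time (crossings x y).
Proof. by []. Qed.

(** The statistic at time [2 * (j + m)] is at least the sum of the [m] groups
    after group [j]. *)
Lemma kcusum_time_le x y j :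
  kcusum_time k delta h x y <= (2 * j)%:R%:E +
    2%:E * c1_time k delta h (shift (2 * j) x) (shift (2 * j) y).
Proof.
rewrite c1_timeE kcusum_timeE.
case: (first_timeP (crossings _ _)) => [_|m [m1 hm] _].
  by rewrite gt0_muley ?lte_fin // addey // leey.
rewrite -EFinM -EFinD -!natrM -natrD -mulnDr.
apply: first_time_le; split; first by lia.
exact: lt_le_trans hm (block_sum_le_kcusum _ _ _ _ _ _).
Qed.

(** An alarm at an odd time would have been raised one step earlier. *)
Lemma kcusum_time_not_odd x y j :
  (2 * j)%:R%:E < kcusum_time k delta h x y ->
  (2 * j).+1%:R%:E < kcusum_time k delta h x y.
Proof.
move=> /lt_first_time Tj; apply/lt_first_time => n [n2 hn].
have := Tj n (conj n2 hn); rewrite leq_eqVlt => /predU1P[nE|//].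
move: hn; rewrite -nE kcusum_stat_odd => hn.
suff : (2 * j < 2 * j)%N by lia.
by apply: Tj; split => //; lia.
Qed.

Hypothesis h_ge0 : (0 <= h)%R.

(** A positive value of the statistic at the alarm is a sum over groups after
    some group [j], and that sum exceeds [h]. *)
Lemma kcusum_time_lty x y : kcusum_time k delta h x y < +oo ->
  exists2 j, (2 * j)%:R%:E < kcusum_time k delta h x y &
    c1_time k delta h (shift (2 * j) x) (shift (2 * j) y) < +oo.
Proof.
rewrite kcusum_timeE; case: first_timeP => // n [n2 hn] nmin _.
have [l nE] : exists l, n = (2 * l)%N.
  exists n./2; have := odd_double_half n; rewrite -mul2n.
  have [nodd|_] := boolP (odd n); last by rewrite add0n => ->.
  rewrite add1n => nE; move: hn; rewrite -nE kcusum_stat_odd => hn.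
  suff : (n <= 2 * n./2)%N by lia.
  by apply: nmin; split=> //; lia.
have [j jl ZE] := kcusum_is_block_sum k delta x y l.
move: hn; rewrite nE ZE => hn.
have {}jl : (j < l)%N.
  rewrite ltn_neqAle jl andbT; apply/eqP => jE; move: hn.
  by rewrite jE subnn /block_sum big_geq // ltNge h_ge0.
exists j; first by rewrite lte_fin ltr_nat; lia.
by apply/first_time_lty; exists (l - j)%N; split => //; lia.
Qed.

End KCusumTime.

(** * The expectation of a first time is the sum of its tail probabilities *)

Section LayerCake.
Context {R : realType}.
Local Open Scope ereal_scope.

Lemma sum_lt_nat n N :
  \sum_(0 <= r < N) ((r < n)%N%:R : R)%:E = (minn N n)%:R%:E.
Proof.
elim: N => [|N IH]; first by rewrite big_geq // min0n.
rewrite big_nat_recr //= IH -EFinD -natrD; congr (_%:R%:E).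
by case: ltnP => ?; lia.
Qed.

Lemma first_time_layers (A : set nat) :
  first_time A =
  \sum_(r <oo) ((r%:R%:E < (first_time A : \bar R))%E%:R : R)%:E.
Proof.
case: first_timeP => [_|n _ _]; apply/esym/cvg_lim => //.
  rewrite (_ : (fun N => _) = fun N => N%:R%:E); first exact/cvgenyP.
  apply/funext => N; under eq_bigr do rewrite ltry.
  by rewrite sumEFin -natr_sum sum_nat_const_nat subn0 muln1.
apply: cvg_near_cst; exists n => // N /= nN.
under eq_bigr do rewrite lte_fin ltr_nat.
by rewrite sum_lt_nat (minn_idPr nN).
Qed.

End LayerCake.

Section IntegralFirstTime.
Context {d : measure_display} {T : measurableType d} {R : realType}.
Variable A : T -> set nat.
Local Open Scope ereal_scope.

Definition later (r : nat) : set T :=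
  [set w | r%:R%:E < (first_time (A w) : \bar R)].

Lemma measurable_later r :
  (forall n, (n <= r)%N -> measurable [set w | A w n]) -> measurable (later r).
Proof.
move=> mA; rewrite (_ : later r = \bigcap_(n in `I_r.+1) ~` [set w | A w n]).
  by apply: bigcap_measurable => [|n /= nr]; [exists 0%N|exact/measurableC/mA].
apply/seteqP; split => [w /lt_first_time H n /= nr /H|w H].
  by rewrite ltnNge -ltnS nr.
by apply/lt_first_time => n An; rewrite ltnNge -ltnS; apply/negP => /H.
Qed.

Hypothesis mlater : forall r, measurable (later r).

Lemma first_time_indic w :
  (first_time (A w) : \bar R) = \sum_(r <oo) (\1_(later r) w)%:E.
Proof.
rewrite first_time_layers; apply: eq_eseriesr => r _.
by rewrite indicE; congr (_%:R%:E); rewrite mem_setE.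
Qed.

Lemma measurable_first_time :
  measurable_fun setT (fun w => first_time (A w) : \bar R).
Proof.
under eq_fun do rewrite first_time_indic.
apply: ge0_emeasurable_sum => [r w _ _|r _]; first by rewrite lee_fin.
exact/measurable_EFinP/measurable_indic.
Qed.

Lemma integral_first_time (mu : {measure set T -> \bar R}) D : measurable D ->
  \int[mu]_(w in D) first_time (A w) = \sum_(r <oo) mu (D `&` later r).
Proof.
move=> mD; under eq_integral do rewrite first_time_indic.
rewrite integral_nneseries //.
- by apply: eq_eseriesr => r _; rewrite integral_indic // setIC.
- by move=> r; exact/measurable_funTS/measurable_EFinP/measurable_indic.
Qed.

End IntegralFirstTime.

(** * Boxes and the space of sample paths *)

Section Boxes.
Context {d : measure_display} {X : measurableType d} {T : Type}.
Implicit Types (x y : nat -> T -> X) (A B : nat -> set X).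

(** Indices start at 1, as in the data model. *)
Definition box x y (n : nat) A B : set T :=
  [set w | forall i, (1 <= i <= n)%N -> A i (x i w) /\ B i (y i w)].

Definition boxes x y (n : nat) : set_system T :=
  [set C | exists A B, [/\ forall i, measurable (A i),
     forall i, measurable (B i) & C = box x y n A B]].

Lemma boxes_setI x y n : setI_closed (boxes x y n).
Proof.
move=> _ _ [A [B [mA mB ->]]] [A' [B' [mA' mB' ->]]].
exists (fun i => A i `&` A' i), (fun i => B i `&` B' i); split.
- by move=> i; exact: measurableI.
- by move=> i; exact: measurableI.
apply/seteqP; split=> w.
  by move=> [H H'] i ni; have [? ?] := H i ni; have [? ?] := H' i ni.
by move=> H; split=> i /H[[? ?] [? ?]].
Qed.

Lemma boxes_setT x y n : boxes x y n setT.
Proof. by exists (fun=> setT), (fun=> setT); split => //; apply/seteqP. Qed.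

Lemma boxes_widen x y n m : (n <= m)%N -> boxes x y n `<=` boxes x y m.
Proof.
move=> nm _ [A [B [mA mB ->]]].
exists (fun i => if (i <= n)%N then A i else setT),
  (fun i => if (i <= n)%N then B i else setT).
split => [i|i|]; [by case: ifP|by case: ifP|].
apply/seteqP; split => w H i /andP[i1 im].
  by case: ifP => // ni; apply: H; apply/andP; split.
by have := H i; rewrite i1 im (leq_trans im nm) => /(_ isT).
Qed.

Definition all_boxes x y : set_system T := \bigcup_n boxes x y n.

Lemma all_boxes_setI x y : setI_closed (all_boxes x y).
Proof.
move=> C C' [n _ nC] [m _ mC]; exists (maxn n m) => //.
apply: boxes_setI.
  by apply: boxes_widen nC; exact: leq_maxl.
by apply: boxes_widen mC; exact: leq_maxr.
Qed.

Lemma box_coord_l x y n i (A : set X) : measurable A -> (1 <= i <= n)%N ->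
  boxes x y n (x i @^-1` A).
Proof.
move=> mA ni; exists (fun j => if j == i then A else setT), (fun=> setT).
split => // [j|]; first by case: ifP.
apply/seteqP; split => [w Aw j _|w /(_ i ni)]; last by rewrite eqxx => -[].
by case: eqP => // ->.
Qed.

Lemma box_coord_r x y n i (A : set X) : measurable A -> (1 <= i <= n)%N ->
  boxes x y n (y i @^-1` A).
Proof.
move=> mA ni; exists (fun=> setT), (fun j => if j == i then A else setT).
split => // [j|]; first by case: ifP.
apply/seteqP; split => [w Aw j _|w /(_ i ni)]; last by rewrite eqxx => -[].
by case: eqP => // ->.
Qed.

Lemma box_cat x y m n A B A' B' :
  box x y m A B `&` box (fun i => x (m + i)%N) (fun i => y (m + i)%N) n A' B' =
  box x y (m + n) (fun i => if (i <= m)%N then A i else A' (i - m)%N)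
                  (fun i => if (i <= m)%N then B i else B' (i - m)%N).
Proof.
apply/seteqP; split => [w [H H'] i ni|w H].
  case: ifPn => im; first by apply: H; lia.
  by have := H' (i - m)%N; rewrite subnKC; [apply; lia|lia].
split => i ni; first by have := H i; rewrite (_ : (i <= m)%N); [apply; lia|lia].
have := H (m + i)%N; rewrite (_ : (m + i <= m)%N = false); last by lia.
by rewrite addKn; apply; lia.
Qed.

End Boxes.

Section PathSpace.
Context {d : measure_display} {X : measurableType d}.

Let xs (i : nat) (s : nat -> X * X) : X := (s i).1.
Let ys (i : nat) (s : nat -> X * X) : X := (s i).2.

(** Sequences of pairs, with the sigma-algebra generated by the coordinates of
    positive index, presented by the pi-system of boxes so that measures can be
    compared on it. *)
Definition path_space : Type := g_sigma_algebraType (all_boxes xs ys).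
HB.instance Definition _ := Measurable.on path_space.

Definition path_x (i : nat) (s : path_space) : X := (s i).1.
Definition path_y (i : nat) (s : path_space) : X := (s i).2.

Lemma measurable_path :
  @measurable _ path_space = <<s all_boxes path_x path_y >>.
Proof. by []. Qed.

Lemma measurable_path_x i : (1 <= i)%N -> measurable_fun setT (path_x i).
Proof.
move=> i1 _ A mA; rewrite setTI; apply: sub_sigma_algebra; exists i => //.
by apply: box_coord_l => //; rewrite i1 leqnn.
Qed.

Lemma measurable_path_y i : (1 <= i)%N -> measurable_fun setT (path_y i).
Proof.
move=> i1 _ A mA; rewrite setTI; apply: sub_sigma_algebra; exists i => //.
by apply: box_coord_r => //; rewrite i1 leqnn.
Qed.

Context {d' : measure_display} {Omega : measurableType d'} {R : realType}.
Variables (x y : nat -> {mfun Omega >-> X}).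

(** The path after time [m]. *)
Definition sample_path (m : nat) (w : Omega) : path_space :=
  fun i => (x (m + i)%N w, y (m + i)%N w).

End PathSpace.

(** * Independence of the past and the future *)

Lemma pi_measure_unique d (T : measurableType d) (R : realType)
    (m1 m2 : {measure set T -> \bar R}) (G : set_system T) :
  G `<=` measurable -> setI_closed G -> G setT -> (m1 setT < +oo)%E ->
  (forall A, G A -> m1 A = m2 A) -> forall E, <<s G >> E -> m1 E = m2 E.
Proof.
move=> mG GI GT m1T m12.
by apply: (@g_sigma_algebra_measure_unique _ _ _ G mG (fun=> setT)) => //;
  exact: bigcup_const.
Qed.

Section PastFuture.
Context {d d' : measure_display} {X : measurableType d}
  {Omega : measurableType d'} {R : realType}.
Variables (x y : nat -> {mfun Omega >-> X}).
Implicit Types (P Q : probability Omega R).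
Local Notation xs := (fun i w => x i w).
Local Notation ys := (fun i w => y i w).
Local Open Scope ereal_scope.

Lemma sigma_of_finite_cap (z : nat -> {mfun Omega >-> X}) (D : set nat)
    (s : seq nat) (A : nat -> set X) : [set` s] `<=` D ->
  (forall i, measurable (A i)) ->
  sigma_of D z (\bigcap_(i in [set` s]) (z i @^-1` A i)).
Proof.
move=> sD mA; rewrite /sigma_of; set G := \bigcup_(i in D) _.
apply: (@fin_bigcap_measurable _ (g_sigma_algebraType G)) => // i si.
apply: sub_sigma_algebra; exists i; first exact: sD.
by exists (A i) => //; rewrite setTI.
Qed.

Lemma box_capE n (A B : nat -> set X) : box xs ys n A B =
  (\bigcap_(i in [set` iota 1 n]) (x i @^-1` A i)) `&`
  (\bigcap_(i in [set` iota 1 n]) (y i @^-1` B i)).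
Proof.
apply/seteqP; split => [w H|w [HA HB] i ni].
  by split=> i /=; rewrite mem_iota => /H[].
by split; [apply: HA|apply: HB]; rewrite /= mem_iota.
Qed.

Lemma prob_box P law p0 n (A B : nat -> set X) :
  data_model P x y law p0 ->
  (forall i, measurable (A i)) -> (forall i, measurable (B i)) ->
  P (box xs ys n A B) = \prod_(1 <= i < n.+1) (law i (A i) * p0 (B i)).
Proof.
move=> [indx indy indxy lawx lawy] mA mB.
have sD : [set` iota 1 n] `<=` pos_index.
  by move=> i /=; rewrite mem_iota => /andP[].
rewrite box_capE indxy; [|exact: sigma_of_finite_cap..].
rewrite indx ?iota_uniq // indy ?iota_uniq // -big_split /=.
rewrite /index_iota subSS subn0; apply: eq_big_seq => i.
rewrite mem_iota => /andP[i1 _].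
by rewrite -(lawx i i1 _ (mA i)) -(lawy i i1 _ (mB i)).
Qed.

Lemma filtration_boxes n : filtration x y n `<=` <<s boxes xs ys n >>.
Proof.
have sub (z : nat -> {mfun Omega >-> X}) :
    (forall i A, (1 <= i <= n)%N -> measurable A ->
       boxes xs ys n (z i @^-1` A)) ->
    sigma_of [set i | (1 <= i <= n)%N] z `<=` <<s boxes xs ys n >>.
  move=> zbox; apply: smallest_sub; first exact: smallest_sigma_algebra.
  move=> _ [i ni [A mA <-]]; apply: sub_sigma_algebra.
  by rewrite setTI; exact: zbox.
apply: smallest_sub; first exact: smallest_sigma_algebra.
move=> F []; apply: sub => i A ni mA; first exact: box_coord_l.
exact: box_coord_r.
Qed.

Lemma filtration_mono n m : (n <= m)%N ->
  filtration x y n `<=` filtration x y m.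
Proof.
move=> nm; apply: sub_sigma_algebra2; apply: setUSS; apply: sub_sigma_algebra2;
  by apply: bigcup_subset => i /= /andP[-> /leq_trans]; exact.
Qed.

Lemma boxes_measurable n : boxes xs ys n `<=` @measurable _ Omega.
Proof.
move=> _ [A [B [mA mB ->]]]; rewrite box_capE; apply: measurableI;
  by apply: fin_bigcap_measurable => // i _; exact: measurable_funPTI.
Qed.

Lemma filtration_measurable n : filtration x y n `<=` @measurable _ Omega.
Proof.
move=> F /filtration_boxes; apply: smallest_sub; last exact: boxes_measurable.
exact: sigma_algebra_measurable.
Qed.

Lemma measurable_sample_path m : measurable_fun setT (sample_path x y m).
Proof.
apply: (@measurability _ _ Omega (@path_space _ X) _ _ _
  (@measurable_path _ X)) => _ [_ [n _ [A [B [mA mB ->]]]] <-].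
rewrite setTI; apply: (@boxes_measurable (m + n)).
exists (fun i => if (i <= m)%N then setT else A (i - m)%N),
  (fun i => if (i <= m)%N then setT else B (i - m)%N).
split => [i|i|]; [by case: ifP|by case: ifP|].
rewrite -(box_cat xs ys m n (fun=> setT) (fun=> setT)).
by rewrite (_ : box xs ys m _ _ = setT) ?setTI //; apply/seteqP.
Qed.

(** The measures [P] and [Q] may differ: under [P] the future starts at [m + 1],
    under [Q] it starts at 1, and the two futures have the same laws. *)
Variables (P Q : probability Omega R) (lawP lawQ : nat -> probability X R).
Variables (p0 : probability X R) (m : nat).
Hypotheses (hP : data_model P x y lawP p0) (hQ : data_model Q x y lawQ p0).
Hypothesis law_shift : forall i A, (1 <= i)%N -> measurable A ->
  lawP (m + i)%N A = lawQ i A.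

(** A past box and a future box form one box, whose probability is a product. *)
Let past_future_boxes n F E : boxes xs ys m F ->
  boxes path_x path_y n E ->
  P (F `&` sample_path x y m @^-1` E) = P F * Q (sample_path x y 0 @^-1` E).
Proof.
move=> [A [B [mA mB ->]]] [A' [B' [mA' mB' ->]]].
have -> : sample_path x y m @^-1` box path_x path_y n A' B' =
  box (fun i => xs (m + i)%N) (fun i => ys (m + i)%N) n A' B' by [].
have -> : sample_path x y 0 @^-1` box path_x path_y n A' B' =
  box xs ys n A' B' by [].
rewrite box_cat (prob_box _ hP) ?(prob_box _ hP) ?(prob_box _ hQ) //;
  last 2 first.
- by move=> i; case: ifP.
- by move=> i; case: ifP.
rewrite (big_cat_nat (n := m.+1)) ?ltnS ?leq_addr //=; congr (_ * _).
  by apply: eq_big_nat => i /andP[_]; rewrite ltnS => ->.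
rewrite -{1}[m.+1]add1n big_addn -addnS addKn.
apply: eq_big_nat => i /andP[i1 _].
have -> : (i + m <= m)%N = false by lia.
by rewrite addnK addnC law_shift.
Qed.

(** Both sides are finite measures in [F] for a fixed future box [E], and then
    in [E] for a fixed [F], so their equality extends from boxes to the
    generated sigma-algebras one argument at a time. *)
Lemma past_future F E : filtration x y m F -> measurable E ->
  P (F `&` sample_path x y m @^-1` E) = P F * Q (sample_path x y 0 @^-1` E).
Proof.
move=> /filtration_boxes mF.
have mpath j (C : set (path_space (X := X))) : measurable C ->
    measurable (sample_path x y j @^-1` C).
  move=> mC; rewrite -[X in measurable X]setTI.
  exact: measurable_sample_path.
(* [mscale] takes its factor as a nonnegative real *)
have scale (mu : probability Omega R) C : measurable C ->
    exists r : {nonneg R}, mu C = r%:num%:E.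
  move=> mC; have fC := fin_num_measure mu _ mC.
  by exists (NngNum (fine_ge0 (measure_ge0 mu C))); rewrite /= fineK.
have onF n C : boxes path_x path_y n C ->
    P (F `&` sample_path x y m @^-1` C) = P F * Q (sample_path x y 0 @^-1` C).
  move=> nC.
  have mC : measurable C by apply: sub_sigma_algebra; exists n.
  have [r Qr] := scale Q _ (mpath 0%N _ mC).
  rewrite Qr muleC.
  apply: (@pi_measure_unique _ _ _ (mrestr P (mpath m _ mC)) (mscale r P)
    _ _ _ _ _ _ _ mF).
  - exact: boxes_measurable.
  - exact: boxes_setI.
  - exact: boxes_setT.
  - by rewrite /= /mrestr setTI ltey_eq fin_num_measure //; exact: mpath.
  - move=> C' mC'; rewrite /= /mrestr /mscale -Qr muleC.
    exact: past_future_boxes nC.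
have mF' : measurable F by apply: smallest_sub mF;
  [exact: sigma_algebra_measurable|exact: boxes_measurable].
move=> mE; have [r Pr] := scale P _ mF'; rewrite Pr.
have mS j := @measurable_sample_path j.
rewrite setIC.
pose m1 : {measure set (path_space (X := X)) -> \bar R} :=
  pushforward (mrestr P mF') (sample_path x y m).
pose m2 : {measure set (path_space (X := X)) -> \bar R} :=
  mscale r (pushforward Q (sample_path x y 0)).
apply: (@pi_measure_unique _ _ _ (m1 (mS m)) (m2 (mS 0%N))
  (all_boxes path_x path_y) _ _ _ _ _ _ mE).
- exact: sub_sigma_algebra.
- exact: all_boxes_setI.
- by exists 0%N => //; exact: boxes_setT.
- rewrite /m1 /= /pushforward /mrestr preimage_setT setTI.
  by rewrite ltey_eq fin_num_measure.
- move=> C [n _ nC].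
  rewrite /m1 /m2 /= /mscale /= /pushforward /mrestr -Pr setIC.
  exact: onF nC.
Qed.

End PastFuture.

(** * Measurability of the statistic *)

Section StatisticMeasurability.
Context {d dT : measure_display} {X : measurableType d} {T : measurableType dT}
  {R : realType}.
Variables (k : X * X -> R) (mk : measurable_fun setT k) (delta h : R).
Implicit Types u v : nat -> T -> X.

Lemma measurable_gstat (a a' b b' : T -> X) :
  measurable_fun setT a -> measurable_fun setT a' ->
  measurable_fun setT b -> measurable_fun setT b' ->
  measurable_fun setT (fun w => gstat k delta (a w, a' w) (b w, b' w)).
Proof.
move=> ma ma' mb mb'; rewrite /gstat /=.
have mkp (f g : T -> X) : measurable_fun setT f -> measurable_fun setT g ->
    measurable_fun setT (fun w => k (f w, g w)).
  by move=> mf mg; apply: (measurableT_comp mk); exact: measurable_fun_pair.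
by repeat apply: measurable_funB => //; try apply: measurable_funD; exact: mkp.
Qed.

Lemma measurable_block_sum u v m :
  (forall i, (1 <= i)%N -> measurable_fun setT (u i)) ->
  (forall i, (1 <= i)%N -> measurable_fun setT (v i)) ->
  measurable_fun setT (fun w => block_sum k delta (u ^~ w) (v ^~ w) m).
Proof.
move=> mu mv; elim: m => [|m IH].
  rewrite (_ : (fun w => _) = cst 0); first exact: measurable_cst.
  by apply/funext => w; rewrite /block_sum big_geq.
under eq_fun do rewrite block_sumS.
apply: measurable_funD IH _.
by apply: measurable_gstat; (apply: mu || apply: mv); lia.
Qed.

(** Only the coordinates up to [n] are used, so that the lemma applies to
    [filtration x y n]. *)
Lemma measurable_kcusum_stat u v n :
  (forall i, (1 <= i <= n)%N -> measurable_fun setT (u i)) ->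
  (forall i, (1 <= i <= n)%N -> measurable_fun setT (v i)) ->
  measurable_fun setT (fun w => kcusum_stat k delta (u ^~ w) (v ^~ w) n).
Proof.
elim: n => [|[|n] IH] mu mv; [exact: measurable_cst..|].
under eq_fun do rewrite kcusum_statSS.
apply: measurable_maxr; first exact: measurable_cst.
apply: measurable_funD.
  by apply: IH => i ni; (apply: mu || apply: mv); lia.
rewrite /kcusum_incr; case: (odd _); first exact: measurable_cst.
by apply: measurable_gstat; (apply: mu || apply: mv); lia.
Qed.

Lemma measurable_later_crossings u v r :
  (forall i, (1 <= i)%N -> measurable_fun setT (u i)) ->
  (forall i, (1 <= i)%N -> measurable_fun setT (v i)) ->
  measurable
    (later (R := R) (fun w => crossings k delta h (u ^~ w) (v ^~ w)) r).
Proof.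
move=> mu mv; apply: measurable_later => m _.
have [m1|m0] := boolP (1 <= m)%N; last first.
  rewrite (_ : [set w | _] = set0); first exact: measurable0.
  by apply/seteqP; split => // w [] /=; rewrite (negbTE m0).
rewrite (_ : [set w | _] = (fun w => block_sum k delta (u ^~ w) (v ^~ w) m)
    @^-1` [set` `]h, +oo[]); last first.
  apply/seteqP; split => w /=; rewrite /crossings /= in_itv /= andbT //.
  by case.
rewrite -[X in measurable X]setTI.
by apply: measurable_block_sum => //; exact: measurable_itv.
Qed.

Lemma measurable_later_alarms u v r :
  (forall i, (1 <= i <= r)%N -> measurable_fun setT (u i)) ->
  (forall i, (1 <= i <= r)%N -> measurable_fun setT (v i)) ->
  measurable
    (later (R := R) (fun w => alarms k delta h (u ^~ w) (v ^~ w)) r).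
Proof.
move=> mu mv; apply: measurable_later => n nr.
have [n2|n2] := boolP (2 <= n)%N; last first.
  rewrite (_ : [set w | _] = set0); first exact: measurable0.
  by apply/seteqP; split => // w [] /=; rewrite (negbTE n2).
rewrite (_ : [set w | _] = (fun w => kcusum_stat k delta (u ^~ w) (v ^~ w) n)
    @^-1` [set` `]h, +oo[]); last first.
  by apply/seteqP; split => w /=; rewrite /alarms /= in_itv /= andbT; [case|].
rewrite -[X in measurable X]setTI.
apply: measurable_kcusum_stat => // [i ni|i ni]; (apply: mu || apply: mv); lia.
Qed.

End StatisticMeasurability.

(** * Conditional expectations *)

Section ConditionalExpectation.
Context {d : measure_display} {Omega : measurableType d} {R : realType}.
Variables (P : probability Omega R) (G : set_system Omega).
Hypothesis mG : <<s G >> `<=` measurable.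
Local Open Scope ereal_scope.

Section Existence.
Variables (Y : Omega -> \bar R) (mY : measurable_fun setT Y).
Hypotheses (Y_ge0 : forall w, 0 <= Y w) (Y_int : \int[P]_w Y w < +oo).

Let restriction (A : set (g_sigma_algebraType G)) : \bar R := P A.

Let restriction0 : restriction set0 = 0. Proof. exact: measure0. Qed.

Let restriction_ge0 A : 0 <= restriction A. Proof. exact: measure_ge0. Qed.

Let restriction_sigma_additive : semi_sigma_additive restriction.
Proof.
move=> F mF tF mUF; apply: measure_semi_sigma_additive => //; last exact: mG.
by move=> i; apply: mG; exact: mF.
Qed.

HB.instance Definition _ := isMeasure.Build _ _ _ restriction
  restriction0 restriction_ge0 restriction_sigma_additive.

Let restriction_fin : fin_num_fun restriction.
Proof. by move=> A mA; apply: fin_num_measure; exact: mG. Qed.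

HB.instance Definition _ :=
  Measure_isFinite.Build _ _ _ restriction restriction_fin.

Let weighted (A : set (g_sigma_algebraType G)) : \bar R := \int[P]_(w in A) Y w.

Let weighted0 : weighted set0 = 0. Proof. exact: integral_set0. Qed.

Let weighted_ge0 A : 0 <= weighted A. Proof. exact: integral_ge0. Qed.

Let weighted_sigma_additive : semi_sigma_additive weighted.
Proof.
move=> F mF tF mUF.
apply: semi_sigma_additive_nng_induced => //; last exact: mG.
by move=> i; apply: mG; exact: mF.
Qed.

HB.instance Definition _ := isMeasure.Build _ _ _ weighted
  weighted0 weighted_ge0 weighted_sigma_additive.

Let weighted_fin : fin_num_fun weighted.
Proof.
move=> A /mG mA; rewrite ge0_fin_numE //; apply: le_lt_trans Y_int.
by apply: ge0_subset_integral => //; exact: measurableT.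
Qed.

HB.instance Definition _ := Measure_isFinite.Build _ _ _ weighted weighted_fin.

(** The density, with respect to the restriction of [P] to [<<s G >>], of the
    finite measure that integrates [Y]. *)
Lemma cond_exp_exists : exists f, is_cond_exp P <<s G >> Y f.
Proof.
have dom : weighted `<< restriction.
  apply/null_content_dominatesP => A /mG mA PA0.
  by apply: null_set_integral => //; exact: measurable_funTS.
have [f [f_ge0 f_int fE]] := radon_nikodym_finite dom.
have mf := measurable_int _ f_int.
exists f; split => // [B mB|A mA].
  by rewrite -[X in <<s _ >> X]setTI; exact: mf.
transitivity (weighted A) => //; rewrite fE //.
have mid : measurable_fun setT (idfun : Omega -> g_sigma_algebraType G).
  by move=> _ B /mG mB; rewrite setTI.
have := @ge0_integral_pushforward _ _ _ _ _ _ mid P A f mA.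
by move=> /(_ (measurable_funTS mf) (fun w _ => f_ge0 w)) /esym.
Qed.

End Existence.

(** The set [A] where [f] exceeds [K] belongs to [<<s G >>], and the nonnegative
    function [f - K] has integral at most 0 on [A]. *)
Lemma ess_sup_cond_exp_le (Y f : Omega -> \bar R) (K : R) : (0 <= K)%R ->
  is_cond_exp P <<s G >> Y f ->
  (forall A, <<s G >> A -> \int[P]_(w in A) Y w <= K%:E * P A) ->
  ess_sup P f <= K%:E.
Proof.
move=> K_ge0 [f_ge0 mf fE] YK; apply: ereal_inf_lbound => /=.
have mfT : measurable_fun setT f.
  by move=> _ B mB; rewrite setTI; apply: mG; exact: mf.
pose A := f @^-1` `]K%:E, +oo[.
have GA : <<s G >> A by apply: mf; exact: emeasurable_itv.
have mA := mG GA.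
have Kf w : A w -> 0 < f w - K%:E.
  by rewrite sube_gt0 /A /= in_itv /= andbT.
have mfK : measurable_fun A (fun w => f w - K%:E).
  by apply: emeasurable_funB; [exact: measurable_funTS|exact: measurable_cst].
have /(ae_eq_integral_abs _ mA mfK) fK : \int[P]_(w in A) `|f w - K%:E| = 0.
  under eq_integral => w /set_mem /Kf /ltW wK do rewrite gee0_abs //.
  apply/eqP; rewrite eq_le; apply/andP; split; last first.
    by apply: integral_ge0 => w /Kf /ltW.
  have : \int[P]_(w in A) (K%:E + (f w - K%:E)) <= K%:E * P A.
    rewrite (eq_integral f) => [|w _]; last by rewrite addeC subeK.
    by rewrite fE //; exact: YK.
  rewrite (@ge0_integralD _ _ _ P A mA (cst K%:E)) //; last first.
    by move=> w /Kf /ltW.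
  rewrite integral_cst // -[leRHS]adde0 leeD2lE //.
  by rewrite fin_numM // fin_num_measure.
apply: filterS fK => w fwK; rewrite leNgt; apply/negP => Kw.
have Aw : A w by rewrite /A /= in_itv /= Kw.
by have := Kf w Aw; rewrite fwK //= ltxx.
Qed.

End ConditionalExpectation.

(** * Alarms and crossings as events *)

Section KernelCusum.
Context {R : realType} {d d' : measure_display} {X : measurableType d}
  {Omega : measurableType d'}.
Variables (k : X * X -> R) (mk : measurable_fun setT k).
Variables (h delta : R) (x y : nat -> {mfun Omega >-> X}).
Local Open Scope ereal_scope.

Definition alarm_time (w : Omega) : \bar R :=
  kcusum_time k delta h (x ^~ w) (y ^~ w).

Definition crossing_time (m : nat) (w : Omega) : \bar R :=
  c1_time k delta h (shift m (x ^~ w)) (shift m (y ^~ w)).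

Local Notation T := alarm_time.
Local Notation c1 := crossing_time.

Let alarm w := alarms k delta h (x ^~ w) (y ^~ w).
Let crossing (s : path_space (X := X)) :=
  crossings k delta h (path_x ^~ s) (path_y ^~ s).

Let later_crossing r : set (path_space (X := X)) := later (R := R) crossing r.

Let crosses : set (path_space (X := X)) :=
  [set s | (first_time (crossing s) : \bar R) < +oo].

Let measurable_later_crossing r : measurable (later_crossing r).
Proof.
by apply: measurable_later_crossings => // i;
  [exact: measurable_path_x|exact: measurable_path_y].
Qed.

Let measurable_crosses : measurable crosses.
Proof.
have mC := @measurable_first_time _ _ _ crossing measurable_later_crossing.
have := mC measurableT _ (emeasurable_itv (Interval -oo%O (BLeft +oo))).
rewrite setTI; congr measurable; apply/seteqP; split => s;
  by rewrite /crosses /= in_itv.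
Qed.

(** The event that there is no alarm up to time [r] is known at time [r]. *)
Lemma filtration_later_alarm r : filtration x y r (later (R := R) alarm r).
Proof.
rewrite /filtration; set D := [set i | _]; set G := _ `|` _.
have coord (z : nat -> {mfun Omega >-> X}) : sigma_of D z `<=` G ->
    forall i, (1 <= i <= r)%N ->
    measurable_fun setT (z i : g_sigma_algebraType G -> X).
  move=> zG i ir _ A mA; rewrite setTI; apply: sub_sigma_algebra; apply: zG.
  by apply: sub_sigma_algebra; exists i => //; exists A => //; rewrite setTI.
apply: (@measurable_later_alarms _ _ X (g_sigma_algebraType G) R k mk delta h
  (fun i w => x i w) (fun i w => y i w)); apply: coord => A; by [left|right].
Qed.

Let measurable_later_alarm r : measurable (later (R := R) alarm r).
Proof.
exact: (@filtration_measurable _ _ _ _ x y r _ (@filtration_later_alarm r)).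
Qed.

Let measurable_T : measurable_fun setT T.
Proof. exact: measurable_first_time measurable_later_alarm. Qed.

Let later_c1 m r : [set w | r%:R%:E < c1 m w] =
  sample_path x y m @^-1` later_crossing r.
Proof. by []. Qed.

(** * The bound on false alarms *)

Section FalseAlarms.
Hypothesis h_ge0 : (0 <= h)%R.
Variables (P : probability Omega R) (p0 : probability X R).
Hypothesis model : no_change_model P x y p0.

Let prob_alarm_then_cross r :
  P (later (R := R) alarm (2 * r) `&` [set w | c1 (2 * r) w < +oo]) =
  P (later (R := R) alarm (2 * r)) * P [set w | c1 0 w < +oo].
Proof.
exact: (past_future model model (fun _ _ _ _ => erefl)
  (@filtration_later_alarm (2 * r)) measurable_crosses).
Qed.

(** An alarm time beyond [2r] is beyond [2r + 1], so each tail probability at an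
    even time is counted twice in the expectation. *)
Let ET_even :
  2%:E * \sum_(r <oo) P (later (R := R) alarm (2 * r)) <= \int[P]_w T w.
Proof.
rewrite (integral_first_time measurable_later_alarm P measurableT).
under [leRHS]eq_eseriesr do rewrite setTI.
rewrite -nneseriesZl //; apply: lime_le.
  by apply: is_cvg_nneseries => r _ _; rewrite mule_ge0 // lee_fin.
apply: nearW => N.
apply: le_trans (nneseries_lim_ge (2 * N) _) => //.
elim: N => [|N IH]; first by rewrite !big_geq.
have -> : (2 * N.+1 = (2 * N).+2)%N by lia.
rewrite !big_nat_recr //= -addeA leeD //.
rewrite -[2%:E]/((1 + 1)%:E) EFinD ge0_muleDl ?lee_fin // mul1e leeD2l //.
apply: le_measure; rewrite ?inE //.
by move=> w; exact: kcusum_time_not_odd.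
Qed.

Lemma false_alarm_bound :
  2%:E / P [set w | c1 0 w < +oo] <= \int[P]_w T w.
Proof.
set a := P _.
have T_ge0 w : 0 <= T w by exact: first_time_ge0.
have ma r : measurable [set w | c1 r w < +oo].
  rewrite -[X in measurable X]setTI.
  exact: (measurable_sample_path x y r measurableT measurable_crosses).
have [->|ET_fin] := eqVneq (\int[P]_w T w) +oo; first by rewrite leey.
have T_int : P.-integrable setT T.
  apply/integrableP; split => //.
  under eq_integral do rewrite gee0_abs //.
  by rewrite ltey.
have mlc r : measurable
    (later (R := R) alarm (2 * r) `&` [set w | c1 (2 * r) w < +oo]).
  exact: measurableI.
(* Almost every outcome has an alarm, hence a group after which the sum
   crosses. *)
have one_le : 1 <= \sum_(r <oo) (P (later (R := R) alarm (2 * r)) * a).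
  under eq_eseriesr do rewrite -prob_alarm_then_cross.
  apply: le_trans (le_mu_bigcup P mlc (bigcup_measurable _)) => //.
  have [N [mN PN0 subN]] := integrable_ae measurableT T_int.
  rewrite -(sube0 1) -PN0 -probability_setC //.
  apply: le_measure; rewrite ?inE //.
  - exact: measurableC.
  - exact: bigcup_measurable.
  move=> w Nw; have /fin_numPlt/andP[_ /(kcusum_time_lty h_ge0)[j Tj cj]] :
      T w \is a fin_num.
    by apply: contra_notT Nw => Tw; apply: subN => /(_ I); exact/negP.
  by exists j.
have [r aE] : exists r, a = r%:E.
  by exists (fine a); rewrite fineK // fin_num_measure.
move: one_le; under eq_eseriesr do rewrite muleC.
rewrite aE nneseriesZl // => one_le.
have r_gt0 : (0 < r)%R.
  rewrite lt_neqAle -lee_fin -aE measure_ge0 andbT.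
  by apply: contraTneq one_le => <-; rewrite mul0e -ltNge lte_fin.
rewrite muleC inver gt_eqF // lee_pdivrMl //.
apply: (@le_trans _ _
  (2%:E * (r%:E * \sum_(i <oo) P (later (R := R) alarm (2 * i))))).
  by rewrite -[leLHS]mule1 lee_wpmul2l // lee_fin.
by rewrite muleCA lee_wpmul2l // lee_fin ltW.
Qed.

End FalseAlarms.

(** * The bound on the detection delay *)

Section DetectionDelay.
Variables (P : nat -> probability Omega R) (p0 p1 : probability X R).
Hypothesis model : forall t, (1 <= t)%N -> change_model (P t) x y p0 p1 t.

Section AtTime.
Variables (t : nat) (t1 : (1 <= t)%N).

(** Group [t./2 + 1], which starts at index [m + 1], is the first one that
    contains no observation before time [t]. *)
Let m := (2 * t./2)%N.

Let delay w := maxe 0 (T w - t%:R%:E).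

Let tm : (t.-1 <= m <= t)%N.
Proof. by have := odd_double_half t; rewrite -mul2n /m; case: (odd t); lia. Qed.

(** The observations after [m >= t.-1] have law [p1] under [P t], as all
    observations do under [P 1]. *)
Let prob_later_crossing A r : filtration x y t.-1 A ->
  P t (A `&` [set w | r%:R%:E < c1 m w]) =
  P t A * P 1%N [set w | r%:R%:E < c1 0 w].
Proof.
move=> /(filtration_mono (n := t.-1) (m := m)) mA.
rewrite !later_c1; apply: (past_future (model t1) (model (leqnn 1))) => //.
  move=> i B i1 mB; have -> : (m + i < t)%N = false by lia.
  by have -> : (i < 1)%N = false by lia.
by apply: mA; lia.
Qed.

Let mc1 j r : measurable [set w | r%:R%:E < c1 j w].
Proof.
rewrite later_c1 -[X in measurable X]setTI.
exact: (measurable_sample_path x y j measurableT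
  (@measurable_later_crossing r)).
Qed.

Let measurable_c1 j : measurable_fun setT (c1 j).
Proof. exact: (measurable_first_time (@mc1 j)). Qed.

Let integral_c1 A : filtration x y t.-1 A ->
  \int[P t]_(w in A) c1 m w = P t A * \int[P 1%N]_w c1 0 w.
Proof.
move=> FA; have mA := filtration_measurable FA.
rewrite (integral_first_time (@mc1 m) (P t) mA).
rewrite (integral_first_time (@mc1 0) (P 1%N) measurableT).
transitivity (\sum_(r <oo) (P t A * P 1%N [set w | r%:R%:E < c1 0 w])).
  by apply: eq_eseriesr => r _; exact: prob_later_crossing.
rewrite -(fineK (fin_num_measure (P t) _ mA)) nneseriesZl //; congr (_ * _).
by apply: eq_eseriesr => r _; rewrite setTI.
Qed.

Let delay_le w : delay w <= 2%:E * c1 m w.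
Proof.
have c1_ge0 : 0 <= c1 m w by exact: first_time_ge0.
rewrite /delay ge_max; apply/andP; split; first by rewrite mule_ge0 // lee_fin.
rewrite leeBlDr //.
apply: le_trans (kcusum_time_le _ _ _ _ _ t./2) _; rewrite -/m addeC.
by rewrite leeD2l // lee_fin ler_nat; case/andP: tm.
Qed.

Let measurable_delay : measurable_fun setT delay.
Proof.
apply: measurable_maxe; first exact: measurable_cst.
by apply: emeasurable_funB; last exact: measurable_cst.
Qed.

Lemma delay_bound_at :
  ess_sup (P t) (cond_exp (P t) (filtration x y t.-1) delay) <=
  2%:E * \int[P 1%N]_w c1 0 w.
Proof.
have c1_ge0 j w : 0 <= c1 j w by exact: first_time_ge0.
have delay_ge0 w : 0 <= delay w by rewrite /delay le_max lexx.
have [Ey|Ec1_fin] := eqVneq (\int[P 1%N]_w c1 0 w) +oo.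
  by rewrite Ey gt0_muley ?lte_fin // leey.
have Kfin : \int[P 1%N]_w c1 0 w \is a fin_num.
  by rewrite ge0_fin_numE ?ltey // integral_ge0.
have delayK A : filtration x y t.-1 A ->
    \int[P t]_(w in A) delay w <= (2 * fine (\int[P 1%N]_w c1 0 w))%:E * P t A.
  move=> FA; have mA := filtration_measurable FA.
  rewrite EFinM fineK // -muleA [_ * P t A]muleC -integral_c1 //.
  rewrite -ge0_integralZl //; last exact: measurable_funTS.
  apply: ge0_le_integral => //; first exact: measurable_funTS.
  by apply: measurable_funTS; apply: measurable_funeM.
have [f fE] : exists f, is_cond_exp (P t) (filtration x y t.-1) delay f.
  apply: cond_exp_exists => //; first exact: filtration_measurable.
  apply: le_lt_trans (delayK setT _) _.
    exact: (@measurableT _ (g_sigma_algebraType _)).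
  by rewrite probability_setT mule1 ltry.
have := xgetPex (cst +oo) (ex_intro _ f fE).
rewrite -/(cond_exp _ _ _) => condE.
rewrite -(fineK Kfin) -EFinM; apply: ess_sup_cond_exp_le condE delayK.
  exact: filtration_measurable.
by rewrite mulr_ge0 // fine_ge0 // integral_ge0.
Qed.

End AtTime.

Lemma delay_bound :
  ESADD P (filtration x y) T <= 2%:E * \int[P 1%N]_w c1 0 w.
Proof. by apply: ge_ereal_sup => _ [t t1 <-]; exact: delay_bound_at. Qed.

End DetectionDelay.

End KernelCusum.

Theorem mainTheorem1 (R : realType) (d d' : measure_display)
    (X : measurableType d) (Omega : measurableType d')
    (k : X * X -> R) (kK : is_kernel k)
    (p0 : probability X R)
    (h delta : R) (h_ge0 : 0 <= h) (delta_gt0 : 0 < delta)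
    (x y : nat -> {mfun Omega >-> X}) :
  let T := fun w => kcusum_time k delta h (x ^~ w) (y ^~ w) in
  let c1 := fun w => c1_time k delta h (x ^~ w) (y ^~ w) in
  (forall Pinf : probability Omega R,
     no_change_model Pinf x y p0 ->
     (2%:E / Pinf [set w | (c1 w < +oo)%E] <= ARL2FA Pinf T)%E)
  /\
  (forall (p1 : probability X R) (P : nat -> probability Omega R),
     (forall t, (1 <= t)%N -> change_model (P t) x y p0 p1 t) ->
     characteristic k -> in_Pk k p0 -> in_Pk k p1 ->
     Num.sqrt delta < mmd_dist k p0 p1 ->
     (ESADD P (filtration x y) T <= 2%:E * \int[P 1%N]_w c1 w)%E).
Proof.
have [mk _ _] := kK; split => [Pinf model|p1 P model _ _ _ _].
  exact: (false_alarm_bound mk delta h_ge0 model).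
exact: (delay_bound mk h delta model).
Qed.
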